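(* Let $(X,d)$ be a compact metric space and let $f\colon X\to X$ be a homeomorphism. Then $f$ has the L-shadowing property if and only if the induced hyperspace homeomorphism $2^f\colon 2^X\to 2^X$ has the L-shadowing property.
   Context: The hyperspace $2^X$ is the set of all nonempty compact subsets of $X$, endowed with the Hausdorff metric $d_H$ induced by $d$; it is a compact metric space. The induced map is $2^f(A)=f(A)=\{f(a): a\in A\}$, a homeomorphism of $2^X$. A homeomorphism $g\colon Y\to Y$ of a compact metric space $(Y,\rho)$ has the L-shadowing property if for every $\varepsilon>0$ there exists $\delta>0$ such that for every sequence $(x_k)_{k\in\mathbb{Z}}\subset Y$ satisfying $\rho(g(x_k),x_{k+1})\le\delta$ for every $k\in\mathbb{Z}$ and $\lim_{|k|\to\infty}\rho(g(x_k),x_{k+1})=0$, there is $z\in Y$ satisfying $\rho(g^k(z),x_k)\le\varepsilon$ for every $k\in\mathbb{Z}$ and $\lim_{|k|\to\infty}\rho(g^k(z),x_k)=0$. *)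

(* Defs.v *)
From HB Require Import structures.
From mathcomp Require Import all_boot all_order all_algebra.
From mathcomp Require Import all_classical all_reals all_analysis.

Set Implicit Arguments.
Unset Strict Implicit.
Unset Printing Implicit Defensive.

Import Order.TTheory GRing.Theory Num.Theory.
Import numFieldTopology.Exports numFieldNormedType.Exports.
Import metricType_numDomainType.

Local Open Scope classical_set_scope.
Local Open Scope ring_scope.

(* The inverse is part of the data; it is determined by the map. *)
Record homeo (T : topologicalType) := Homeo {
  homeo_fun :> T -> T;
  homeo_inv : T -> T;
  homeo_funK : cancel homeo_fun homeo_inv;
  homeo_invK : cancel homeo_inv homeo_fun;
  homeo_fun_continuous : continuous homeo_fun;
  homeo_inv_continuous : continuous homeo_inv
}.

(* [Negz n] is - (n + 1). *)
Definition homeo_iter (T : topologicalType) (f : homeo T) (k : int) : T -> T :=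
  match k with
  | Posz n => iter n f
  | Negz n => iter n.+1 (homeo_inv f)
  end.

(* The filter "|k| -> oo" on the integers. *)
Definition absz_oo : set_system int :=
  filter_from [set: nat] (fun N => [set k : int | (N <= `|k|)%N]).

Global Instance absz_oo_proper : ProperFilter absz_oo.
Proof.
apply: filter_from_proper; last by move=> N _; exists (Posz N) => /=.
apply: filter_from_filter; first by exists 0%N.
move=> M N _ _; exists (maxn M N) => // k /=.
by rewrite geq_max => /andP[].
Qed.

Definition L_shadowing (R : realType) (Y : metricType R) (g : homeo Y) : Prop :=
  forall eps : R, 0 < eps ->
  exists2 delta : R, 0 < delta &
  forall x : int -> Y,
    (forall k, mdist (g (x k)) (x (k + 1)) <= delta) ->
    mdist (g (x k)) (x (k + 1)) @[k --> absz_oo] --> (0 : R) ->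
    exists z : Y,
      (forall k, mdist (homeo_iter g k z) (x k) <= eps) /\
      mdist (homeo_iter g k z) (x k) @[k --> absz_oo] --> (0 : R).

Record hyperspace (T : topologicalType) := Hyperspace {
  hyper_set :> set T;
  hyper_compact : compact hyper_set;
  hyper_neq0 : hyper_set !=set0
}.

Lemma hyper_ext (T : topologicalType) (A B : hyperspace T) :
  hyper_set A = hyper_set B -> A = B.
Proof.
by case: A B => [A cA A0] [B cB B0] /= AB; subst B; congr Hyperspace;
  exact: Prop_irrelevance.
Qed.

HB.instance Definition _ (T : topologicalType) :=
  gen_eqMixin (hyperspace T).
HB.instance Definition _ (T : topologicalType) :=
  gen_choiceMixin (hyperspace T).

Definition point_dist (R : realType) (X : metricType R) (x : X) (A : set X) : R :=
  inf [set mdist x a | a in A].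

(* [sup] and [inf] are total; here they are genuine because they are only used
   for nonempty compact sets (point_dist_has_inf, point_dist_has_sup). *)
Definition hausdorff_dist (R : realType) (X : metricType R) (A B : set X) : R :=
  Num.max (sup [set point_dist a B | a in A]) (sup [set point_dist b A | b in B]).

Section hausdorff_metric.
Context {R : realType} {X : metricType R}.
Implicit Types (x y : X) (A B C : hyperspace X).

Lemma point_dist_has_inf x A : has_inf [set mdist x a | a in (A : set X)].
Proof.
split; first by have [a Aa] := hyper_neq0 A; exists (mdist x a), a.
by exists 0 => _ [a _ <-]; exact: mdist_ge0.
Qed.

Lemma point_dist_le x A a : hyper_set A a -> point_dist x A <= mdist x a.
Proof.
by move=> Aa; apply: ge_inf; [exact: (point_dist_has_inf x A).2 | exists a].
Qed.

Lemma le_point_dist x A e :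
  (forall a, hyper_set A a -> e <= mdist x a) -> e <= point_dist x A.
Proof.
move=> eA; apply: lb_le_inf; first exact: (point_dist_has_inf x A).1.
by move=> _ [a Aa <-]; exact: eA.
Qed.

Lemma point_dist_ge0 x A : 0 <= point_dist x A.
Proof. by apply: le_point_dist => a _; exact: mdist_ge0. Qed.

Lemma point_dist_lt x A e :
  point_dist x A < e -> exists2 a, hyper_set A a & mdist x a < e.
Proof.
move=> xAe; have [_ [a Aa <-] ae] := inf_lt (point_dist_has_inf x A).1 xAe.
by exists a.
Qed.

Lemma compact_mdist_bounded (A : set X) x :
  compact A -> exists M : R, forall a, A a -> mdist a x <= M.
Proof.
move=> /compact_near_coveringP.
move=> /(_ R +oo%R (fun M a => mdist a x <= M) _) cA.
suff /cA : forall a, A a ->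
    \forall a' \near a & M \near +oo%R, mdist a' x <= M.
  by move=> /filter_ex[M AM]; exists M.
move=> a Aa.
exists (ball a 1, [set M : R | mdist a x + 1 <= M]).
  by split; [exact: nbhsx_ballx ltr01 | exact: nbhs_pinfty_ge (num_real _)].
move=> [b M] [/=]; rewrite ballEmdist/= => ab aM.
rewrite (le_trans _ aM)// (le_trans (metric_triangle _ a _))//.
by rewrite addrC lerD2l metric_sym ltW.
Qed.

Lemma point_dist_has_sup A B :
  has_sup [set point_dist a B | a in (A : set X)].
Proof.
have [a Aa] := hyper_neq0 A; have [b Bb] := hyper_neq0 B.
split; first by exists (point_dist a B), a.
have [M AM] := compact_mdist_bounded b (@hyper_compact _ A).
by exists M => _ [c Ac <-]; rewrite (le_trans (point_dist_le _ Bb))// AM.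
Qed.

Lemma hausdorff_distC A B : hausdorff_dist A B = hausdorff_dist B A.
Proof. by rewrite /hausdorff_dist maxC. Qed.

Lemma point_dist_le_hausdorff A B a :
  hyper_set A a -> point_dist a B <= hausdorff_dist A B.
Proof.
move=> Aa; rewrite /hausdorff_dist le_max; apply/orP; left.
by apply: ub_le_sup; [exact: (point_dist_has_sup A B).2 | exists a].
Qed.

Lemma hausdorff_dist_le A B e :
  (forall a, hyper_set A a -> point_dist a B <= e) ->
  (forall b, hyper_set B b -> point_dist b A <= e) -> hausdorff_dist A B <= e.
Proof.
move=> AB BA; rewrite /hausdorff_dist ge_max; apply/andP; split.
- apply: ge_sup; first exact: (point_dist_has_sup A B).1.
  by move=> _ [a Aa <-]; exact: AB.
- apply: ge_sup; first exact: (point_dist_has_sup B A).1.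
  by move=> _ [b Bb <-]; exact: BA.
Qed.

Lemma hausdorff_dist_ge0 A B : 0 <= hausdorff_dist A B.
Proof.
have [a Aa] := hyper_neq0 A.
exact: le_trans (point_dist_ge0 a B) (point_dist_le_hausdorff B Aa).
Qed.

Lemma hausdorff_distxx A : hausdorff_dist A A = 0.
Proof.
apply/eqP; rewrite eq_le hausdorff_dist_ge0 andbT.
by apply: hausdorff_dist_le => a Aa;
  rewrite (le_trans (point_dist_le _ Aa))// mdistxx.
Qed.

Lemma hausdorff_dist0_sub A B :
  hausdorff_dist A B = 0 -> (A : set X) `<=` B.
Proof.
move=> AB0 a Aa.
have cB : closed (B : set X).
  exact: compact_closed (@metric_hausdorff _ X) (@hyper_compact _ B).
apply: cB => U /nbhs_ballP[e /= e0 aeU].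
have : point_dist a B < e.
  by rewrite (le_lt_trans (point_dist_le_hausdorff B Aa))// AB0.
by move=> /point_dist_lt[b Bb abe]; exists b; split => //; apply: aeU;
  rewrite ballEmdist.
Qed.

Lemma hausdorff_dist_positivity A B : hausdorff_dist A B = 0 -> A = B.
Proof.
move=> AB0; apply: hyper_ext; apply/seteqP; split; apply: hausdorff_dist0_sub => //.
by rewrite hausdorff_distC.
Qed.

Lemma point_dist_triangle x B C :
  point_dist x C <= point_dist x B + hausdorff_dist B C.
Proof.
rewrite -lerBlDr; apply: le_point_dist => b Bb.
have bC := point_dist_le_hausdorff C Bb.
rewrite lerBlDr (le_trans _ (lerD (lexx _) bC))//.
rewrite -lerBlDl; apply: le_point_dist => c Cc.
by rewrite lerBlDl (le_trans (point_dist_le _ Cc))// metric_triangle.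
Qed.

Lemma hausdorff_dist_triangle B A C :
  hausdorff_dist A C <= hausdorff_dist A B + hausdorff_dist B C.
Proof.
apply: hausdorff_dist_le => [a Aa|c Cc].
- rewrite (le_trans (point_dist_triangle a B C))// lerD2r.
  exact: point_dist_le_hausdorff.
- rewrite (le_trans (point_dist_triangle c B A))// addrC.
  rewrite (hausdorff_distC A B) lerD2l (hausdorff_distC B C).
  exact: point_dist_le_hausdorff.
Qed.

End hausdorff_metric.

HB.instance Definition _ (R : realType) (X : metricType R) :=
  @isMetric.Build R (hyperspace X)
    (fun A B => hausdorff_dist A B)
    hausdorff_distxx hausdorff_dist_positivity hausdorff_distC
    hausdorff_dist_triangle.

Lemma mdist_hyperE (R : realType) (X : metricType R) (A B : hyperspace X) :
  mdist A B = hausdorff_dist A B.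
Proof. by []. Qed.

Definition hyper_map (T : topologicalType) (f : T -> T) (cf : continuous f)
    (A : hyperspace T) : hyperspace T :=
  @Hyperspace T (f @` A)
    (continuous_compact (continuous_subspaceT cf) (@hyper_compact T A))
    (image_nonempty f (@hyper_neq0 T A)).

Lemma hyper_mapK (T : topologicalType) (f g : T -> T)
    (cf : continuous f) (cg : continuous g) :
  cancel f g -> cancel (hyper_map cf) (hyper_map cg).
Proof.
move=> fK A; apply: hyper_ext => /=; rewrite image_comp.
by rewrite (_ : g \o f = id) ?image_id//; apply/funext => x /=; rewrite fK.
Qed.

Lemma continuous_compact_uniform (R : realType) (X : metricType R) (f : X -> X)
    (A : set X) (e : R) : continuous f -> compact A -> 0 < e ->
  exists2 d : R, 0 < d &
    forall a x, A a -> mdist a x < d -> mdist (f a) (f x) <= e.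
Proof.
move=> cf /compact_near_coveringP cA e0.
have e20 : 0 < e / 2 by rewrite divr_gt0.
have /(cA R (0 : R)^'+
    (fun d a => forall x, mdist a x < d -> mdist (f a) (f x) <= e) _) :
    forall a, A a -> \forall a' \near a & d \near (0 : R)^'+,
    forall x, mdist a' x < d -> mdist (f a') (f x) <= e.
  move=> a Aa.
  have /cvgrPdist_lt/(_ _ e20) := cf a.
  move=> /nbhs_ballP[d /= d0 ad].
  have d20 : 0 < d / 2 by rewrite divr_gt0.
  exists (ball a (d / 2), [set r : R | r < d / 2]).
    by split; [exact: nbhsx_ballx | exact: nbhs_right_lt].
  move=> [b r] [/=]; rewrite ballEmdist/= => ab rd x bx.
  have fab : mdist (f a) (f b) < e / 2.
    apply: ad; rewrite ballEmdist/= (lt_trans ab)//.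
    by rewrite ltr_pdivrMr// ltr_pMr// ltr1n.
  have fax : mdist (f a) (f x) < e / 2.
    apply: ad; rewrite ballEmdist/= (le_lt_trans (metric_triangle _ b _))//.
    by rewrite [ltRHS]splitr ltrD// (lt_trans bx).
  rewrite (le_trans (metric_triangle _ (f a) _))// [leRHS]splitr lerD//.
    by rewrite metric_sym ltW.
  exact: ltW.
move=> Ad; near (0 : R)^'+ => d; exists d => // a x Aa.
have Pd : A `<=` (fun a => forall x, mdist a x < d -> mdist (f a) (f x) <= e).
  by near: d.
exact: Pd.
Unshelve. all: by end_near. Qed.

Lemma hyper_map_continuous (R : realType) (X : metricType R) (f : X -> X)
    (cf : continuous f) : continuous (hyper_map cf).
Proof.
move=> A; apply/(@cvgrPdist_le _ _ _ (nbhs A) (nbhs_filter A)) => e e0.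
have [d d0 fd] := continuous_compact_uniform cf (@hyper_compact _ A) e0.
apply/nbhs_ballP; exists d => //= B; rewrite ballEmdist/= mdist_hyperE => ABd.
rewrite mdist_hyperE; apply: hausdorff_dist_le => _ [x Ax <-].
- have [|b Bb xb] := @point_dist_lt _ _ x B d.
    by rewrite (le_lt_trans _ ABd)// point_dist_le_hausdorff.
  have fBb : hyper_set (hyper_map cf B) (f b) by exists b.
  by rewrite (le_trans (point_dist_le _ fBb))// fd.
- have [|a Aa xa] := @point_dist_lt _ _ x A d.
    by rewrite (le_lt_trans _ ABd)// hausdorff_distC point_dist_le_hausdorff.
  have fAa : hyper_set (hyper_map cf A) (f a) by exists a.
  by rewrite (le_trans (point_dist_le _ fAa))// metric_sym fd// metric_sym.
Qed.

Definition hyper_homeo (R : realType) (X : metricType R) (f : homeo X) :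
    homeo (hyperspace X) :=
  Homeo
    (hyper_mapK (@homeo_fun_continuous _ f) (@homeo_inv_continuous _ f)
      (@homeo_funK _ f))
    (hyper_mapK (@homeo_inv_continuous _ f) (@homeo_fun_continuous _ f)
      (@homeo_invK _ f))
    (@hyper_map_continuous R X _ (@homeo_fun_continuous _ f))
    (@hyper_map_continuous R X _ (@homeo_inv_continuous _ f)).

(* Main.v *)
(* For hyperspaces, L-shadowing of single orbits is not enough: the points of
   the shadowing set must converge to the A_k at a common rate. This uniformity
   follows from compactness. Fix errors e_k -> 0 and consider the compact set of
   pseudo-orbits with these errors. L-shadowing replaces a long middle window of
   a pseudo-orbit by a true orbit, and the length of the window is uniform over
   the compact set; the result is a pseudo-orbit with smaller errors. Iterating
   with scales eps/2^n and taking a cluster point gives a true orbit, at distance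
   at most eps/2^j from the initial pseudo-orbit outside a window depending on j
   and e only. The set of all points whose orbits follow the A_k at this
   rate is compact, and it shadows A because every point of every A_m lies on a
   pseudo-orbit x with x_k in A_k. Conversely, a pseudo-orbit in X is a
   pseudo-orbit of singletons, and any point of the shadowing set shadows it. *)
Require Import Defs.
From mathcomp Require Import all_boot all_order all_algebra.
From mathcomp Require Import all_classical all_reals all_analysis.
From mathcomp Require Import zify ring lra.

Set Implicit Arguments.
Unset Strict Implicit.
Unset Printing Implicit Defensive.

Import Order.TTheory GRing.Theory Num.Theory.
Import numFieldTopology.Exports numFieldNormedType.Exports.

Local Open Scope classical_set_scope.
Local Open Scope ring_scope.

(** * Decay at infinity and two-sided orbits *)

(** One-sided bound: it passes to smaller functions and, for nonnegative ones, amounts to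
    convergence to 0. *)
Definition vanishing (R : realType) (u : int -> R) :=
  forall r, 0 < r -> exists N : nat, forall k, (N <= `|k|)%N -> u k <= r.

Lemma vanishingP (R : realType) (u : int -> R) : (forall k, 0 <= u k) ->
  u @ absz_oo --> (0 : R) <-> vanishing u.
Proof.
move=> u0; split=> [/cvgrPdist_le ucvg r /ucvg[N _ Nr]|uv].
  by exists N => k /Nr /=; rewrite sub0r normrN ger0_norm.
apply/cvgrPdist_le => r /uv[N Nr]; exists N => //= k /Nr.
by rewrite sub0r normrN ger0_norm.
Qed.

Lemma vanishing_le (R : realType) (u v : int -> R) :
  (forall k, u k <= v k) -> vanishing v -> vanishing u.
Proof.
move=> uv v0 r /v0[N Nr]; exists N => k /Nr; exact: le_trans.
Qed.

Lemma half_powers_small (R : realType) (eps r : R) :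
  0 < r -> exists n, eps / 2 ^+ n <= r.
Proof.
move=> r0; exists (Num.bound (eps / r)).
have := @upper_nthrootP _ (eps / r) _ (leqnn _).
by rewrite ltr_pdivrMr// ler_pdivrMr ?exprn_gt0// mulrC => /ltW.
Qed.

Lemma homeo_iterS (T : topologicalType) (f : homeo T) k z :
  homeo_iter f (k + 1) z = f (homeo_iter f k z).
Proof.
case: k => [n|[|n]].
- by rewrite (_ : n%:Z + 1 = n.+1%:Z); last lia.
- by rewrite /= homeo_invK.
- by rewrite (_ : Negz n.+1 + 1 = Negz n) /= ?homeo_invK//; lia.
Qed.

Lemma homeo_iter_continuous (T : topologicalType) (f : homeo T) k :
  continuous (homeo_iter f k).
Proof.
have iter_cont (g : T -> T) n : continuous g -> continuous (iter n g).
  move=> cg; elim: n => [x|n IH x] /=; first exact: cvg_id.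
  exact: (@continuous_comp _ _ _ (iter n g) g x (IH x) (cg _)).
case: k => n.
- apply: (iter_cont _ n); exact: homeo_fun_continuous.
- apply: (iter_cont _ n.+1); exact: homeo_inv_continuous.
Qed.

Lemma homeo_iter_orbit (T : topologicalType) (f : homeo T) (w : int -> T) :
  (forall k, f (w k) = w (k + 1)) -> forall k, homeo_iter f k (w 0) = w k.
Proof.
move=> fw; case.
- elim=> [//|n IH]; rewrite (_ : n.+1%:Z = n%:Z + 1); last lia.
  by rewrite homeo_iterS IH fw.
- have fV k : homeo_inv f (w (k + 1)) = w k by rewrite -fw homeo_funK.
  elim=> [|n IH] /=.
    by rewrite -[0 in LHS](_ : Negz 0 + 1 = 0) ?fV.
  rewrite -[homeo_inv f (iter n _ _)]/(homeo_iter f (Negz n) (w 0)) IH.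
  by rewrite (_ : Negz n = Negz n.+1 + 1) ?fV//; lia.
Qed.

Lemma hyper_homeo_iter (R : realType) (X : metricType R) (f : homeo X) k
    (A : hyperspace X) :
  hyper_set (homeo_iter (hyper_homeo f) k A) = homeo_iter f k @` A.
Proof.
have iterE (g : X -> X) (cg : continuous g) n :
    hyper_set (iter n (hyper_map cg) A) = iter n g @` A.
  elim: n => [|n IH]; first by rewrite /= image_id.
  by rewrite /= IH image_comp.
by case: k => n; [exact: (iterE _ _ n)|exact: (iterE _ _ n.+1)].
Qed.

(** * Closed conditions defined by distances *)

Lemma continuous_mdist (R : realType) (T : topologicalType) (X : metricType R)
    (u v : T -> X) : continuous u -> continuous v ->
  continuous (fun t => mdist (u t) (v t)).
Proof.
move=> cu cv t; apply/cvgrPdist_le => r r0.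
have r20 : 0 < r / 2 by rewrite divr_gt0.
have /metricType_numDomainType.cvgr_dist_le/(_ _ r20) := cu t.
have /metricType_numDomainType.cvgr_dist_le/(_ _ r20) := cv t.
apply: filterS2 => s /= vs us; rewrite ler_norml.
have := metric_triangle (u t) (u s) (v t).
have := metric_triangle (u s) (v s) (v t).
have := metric_triangle (u s) (u t) (v s).
have := metric_triangle (u t) (v t) (v s).
rewrite (metric_sym (u s) (u t)) (metric_sym (v s) (v t)); lra.
Qed.

Lemma closed_mdist_le (R : realType) (T : topologicalType) (X : metricType R)
    (u v : T -> X) (c : R) : continuous u -> continuous v ->
  closed [set t | mdist (u t) (v t) <= c].
Proof.
move=> cu cv; apply: (@preimage_closed _ _ (fun t => mdist (u t) (v t))
  [set r | r <= c]) => [t _|]; last exact: closed_le.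
exact: continuous_mdist.
Qed.

(** By the triangle inequality the distance to a set is 1-Lipschitz. *)
Lemma closed_point_dist_le (R : realType) (T : topologicalType)
    (X : metricType R) (u : T -> X) (A : hyperspace X) (c : R) :
  continuous u -> closed [set t | point_dist (u t) A <= c].
Proof.
have lip x y : point_dist x A <= mdist x y + point_dist y A.
  rewrite -lerBlDl; apply: le_point_dist => a Aa.
  by rewrite lerBlDl (le_trans (point_dist_le _ Aa))// metric_triangle.
move=> cu; apply: (@preimage_closed _ _ (fun t => point_dist (u t) A)
  [set r | r <= c]) => [t _|]; last exact: closed_le.
apply/cvgrPdist_le => r r0.
have /metricType_numDomainType.cvgr_dist_le/(_ _ r0) := cu t.
apply: filterS => s /= us; rewrite ler_norml.
have := lip (u t) (u s); have := lip (u s) (u t).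
rewrite (metric_sym (u s) (u t)); lra.
Qed.

(** A minimum, not just an infimum, links points of successive sets with errors bounded by the
    Hausdorff gap itself. *)
Lemma point_dist_attained (R : realType) (X : metricType R) x
    (A : hyperspace X) : exists2 a, hyper_set A a & mdist x a = point_dist x A.
Proof.
have cA := @hyper_compact _ A.
have cx : {within (A : set X), continuous (mdist x)}.
  apply: continuous_subspaceT; apply: continuous_mdist => t; first exact: cvg_cst.
  exact: cvg_id.
have [a /set_mem Aa amin] := compact_EVT_min (@hyper_neq0 _ A) cA cx.
exists a => //; apply/eqP; rewrite eq_le point_dist_le// andbT.
by apply: le_point_dist => b /mem_set; exact: amin.
Qed.

(** * Two-sided sequences and the compact space of pseudo-orbits *)

(** Dependent choice from time [m] in both directions: [g] picks successors, [h] predecessors, and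
    the two rays are glued at [m]. *)
Lemma int_chain (T : Type) (P : int -> T -> Prop) (r : int -> T -> T -> Prop) :
  (forall k a, P k a -> exists2 b, P (k + 1) b & r k a b) ->
  (forall k b, P (k + 1) b -> exists2 a, P k a & r k a b) ->
  forall m a, P m a -> exists x : int -> T,
    [/\ x m = a, forall k, P k (x k) & forall k, r k (x k) (x (k + 1))].
Proof.
move=> fwd bwd m a Pma.
have [[k b] /=|g gP] := @choice _ _ (fun (p : int * T) b =>
    P p.1 p.2 -> P (p.1 + 1) b /\ r p.1 p.2 b).
  by have [/fwd[c]|nP] := pselect (P k b); [exists c|exists b].
have [[k b] /=|h hP] := @choice _ _ (fun (p : int * T) a =>
    P (p.1 + 1) p.2 -> P p.1 a /\ r p.1 a p.2).
  by have [/bwd[c]|nP] := pselect (P (k + 1) b); [exists c|exists b].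
pose u := fix u n := if n is n'.+1 then g (m + n'%:Z, u n') else a.
pose v := fix v n := if n is n'.+1 then h (m - n'.+1%:Z, v n') else a.
have Pu n : P (m + n%:Z) (u n).
  elim: n => [|n IH]; first by rewrite addr0.
  rewrite (_ : m + n.+1%:Z = m + n%:Z + 1); last lia.
  by have [] := gP (m + n%:Z, u n) IH.
have mB n : m - n.+1%:Z + 1 = m - n%:Z by lia.
have Pv n : P (m - n%:Z) (v n).
  elim: n => [|n IH]; first by rewrite subr0.
  by have := hP (m - n.+1%:Z, v n); rewrite /= mB => /(_ IH)[].
pose x k := if (m <= k)%R then u `|k - m|%N else v `|k - m|%N.
have xu n : x (m + n%:Z) = u n.
  rewrite /x ifT; last lia.
  by rewrite (_ : `|_|%N = n)//; lia.
have xv n : x (m - n%:Z) = v n.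
  (* The branch [m <= m - n] occurs only for [n = 0], where both rays equal [a]. *)
  rewrite /x; case: ifPn => mn; last by rewrite (_ : `|_|%N = n)//; lia.
  by have -> : n = 0%N; [lia|rewrite subr0 subrr].
have split_int k : (exists n : nat, k = m + n%:Z) \/
                   (exists n : nat, k = m - n.+1%:Z).
  have [mk|km] := leP m k; [left; exists `|k - m|%N|right; exists `|k - m|.-1%N];
    lia.
exists x; split.
- by have := xu 0%N; rewrite addr0.
- by move=> k; have [[n ->]|[n ->]] := split_int k; rewrite ?xu ?xv.
- move=> k; have [[n ->]|[n ->]] := split_int k.
    rewrite (_ : _ + 1 = m + n.+1%:Z) ?xu; last lia.
    by have [] := gP (m + n%:Z, u n) (Pu n).
  rewrite mB !xv.
  by have := hP (m - n.+1%:Z, v n); rewrite /= mB => /(_ (Pv n))[].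
Qed.

Definition pseudo_orbit (R : realType) (X : metricType R) (f : X -> X)
    (e : int -> R) (x : int -> X) :=
  forall k, mdist (f (x k)) (x (k + 1)) <= e k.

Lemma ptws_eval_continuous (I : eqType) (T : topologicalType) (i : I) :
  continuous (fun x : {ptws I -> T} => x i).
Proof. exact: (@proj_continuous I (fun=> T) i). Qed.

(** The full product is compact by Tychonoff, and each condition is closed because it involves only
    the coordinates [k] and [k + 1]. *)
Lemma compact_pseudo_orbit (R : realType) (X : metricType R) (f : X -> X)
    (e : int -> R) : compact [set: X] -> continuous f ->
  compact [set x : {ptws int -> X} | pseudo_orbit f e x].
Proof.
move=> cX cf.
have cXZ : compact [set x : {ptws int -> X} | forall k, [set: X] (x k)].
  exact: (@tychonoff int (fun=> X) (fun=> setT) (fun=> cX)).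
apply: (subclosed_compact _ cXZ) => //.
have -> : [set x : {ptws int -> X} | pseudo_orbit f e x] =
    \bigcap_k [set x : {ptws int -> X} | mdist (f (x k)) (x (k + 1)) <= e k].
  by apply/seteqP; split=> [x xe k _|x xe k]; [exact: xe|exact: (xe k I)].
apply: closed_bigI => k _; apply: closed_mdist_le.
- move=> x; apply: (@continuous_comp _ _ _ (fun x : {ptws int -> X} => x k) f).
    exact: ptws_eval_continuous.
  exact: cf.
- exact: ptws_eval_continuous.
Qed.

Lemma near_ptws_mdist (R : realType) (X : metricType R) (x : {ptws int -> X})
    (N : nat) (r : R) : 0 < r ->
  \forall y \near x, forall k, (`|k| <= N)%N -> mdist (x k) (y k) <= r.
Proof.
move=> r0.
have ne k : \forall y \near x, mdist (x k) ((y : {ptws int -> X}) k) <= r.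
  have /metricType_numDomainType.cvgr_dist_le := @ptws_eval_continuous _ X k x.
  exact.
elim: N => [|N IH].
  by apply: filterS (ne 0) => y y0 k; rewrite leqn0 absz_eq0 => /eqP->.
have := @filterS3 _ _ (nbhs_filter x) _ _ _ _ _ IH (ne N.+1%:Z) (ne (- N.+1%:Z)).
apply=> y yN yp ym k.
rewrite leq_eqVlt => /orP[/eqP kN|]; last exact: yN.
by have [->|->] : k = N.+1%:Z \/ k = - N.+1%:Z by lia.
Qed.

(* Near a pseudo-orbit shadowed by the orbit of z, every pseudo-orbit can be
   replaced by the orbit of z on a long window |k| <= N at the cost of a jump at
   most eta at each end. Compactness bounds the length of the window. *)
Lemma pseudo_orbit_surgery (R : realType) (X : metricType R) (f : homeo X)
    (eps eta : R) (e : int -> R) :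
  compact [set: X] -> 0 < eps -> 0 < eta -> vanishing e ->
  (forall x, pseudo_orbit f e x -> exists z,
    (forall k, mdist (homeo_iter f k z) (x k) <= eps) /\
    vanishing (fun k => mdist (homeo_iter f k z) (x k))) ->
  exists M : nat, forall x, pseudo_orbit f e x -> exists y,
    [/\ pseudo_orbit f (fun=> eta) y,
        forall k, (M <= `|k|)%N -> y k = x k &
        forall k, mdist (x k) (y k) <= eps + eps].
Proof.
move=> cX eps0 eta0 e0 sh.
(* Three errors add up at the left end of the window: from the orbit to [x], from [x] to the nearby
   [x'], and the error [e k] of [x']. *)
have eta30 : 0 < eta / 3 by rewrite divr_gt0.
have /compact_near_coveringP := @compact_pseudo_orbit R X f e cX
  (@homeo_fun_continuous _ f).
move=> /(_ nat \oo (fun M x => pseudo_orbit f e x -> exists y,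
    [/\ pseudo_orbit f (fun=> eta) y,
        forall k, (M <= `|k|)%N -> y k = x k &
        forall k, mdist (x k) (y k) <= eps + eps]) _).
move=> near_cov; have [|N _ NP] := near_cov _; last first.
  by exists N => x xe; exact: (NP N (leqnn N) x xe).
move=> x xe; have [z [zx zx0]] := sh x xe.
have [N1 N1P] := zx0 _ eta30; have [N2 N2P] := e0 _ eta30.
pose N := maxn N1 N2.
pose t := Num.min eps (eta / 3).
have t0 : 0 < t by rewrite lt_min eps0.
(* Closeness is required up to [N.+1]: the right jump is measured at time [N.+1], the left one at
   time [- N]. *)
exists ([set y : {ptws int -> X} |
    forall k, (`|k| <= N.+1)%N -> mdist (x k) (y k) <= t], [set M | (N < M)%N]).
  by split; [exact: near_ptws_mdist|exists N.+1].
move=> [x' M] /= [xx' NM] x'e.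
have xx'eps k : (`|k| <= N.+1)%N -> mdist (x k) (x' k) <= eps.
  by move=> /xx'; rewrite le_min => /andP[].
have zx' k : `|k|%N = N \/ `|k|%N = N.+1 ->
    mdist (homeo_iter f k z) (x' k) <= eta / 3 + eta / 3.
  move=> kN; rewrite (le_trans (metric_triangle _ (x k) _))// lerD//.
    by apply: N1P; rewrite /N in kN; lia.
  have /xx' : (`|k| <= N.+1)%N by lia.
  by rewrite le_min => /andP[].
exists (fun k => if (`|k| <= N)%N then homeo_iter f k z else x' k); split.
- move=> k; case: ifPn => kN; case: ifPn => k1N.
  + by rewrite -homeo_iterS mdistxx ltW.
  + rewrite -homeo_iterS (le_trans (zx' _ _))//; first by lia.
    by lra.
  + rewrite (le_trans (metric_triangle _ (x' (k + 1)) _))//.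
    have := x'e k; have : e k <= eta / 3 by apply: N2P; rewrite /N in kN; lia.
    have : mdist (homeo_iter f (k + 1) z) (x' (k + 1)) <= eta / 3 + eta / 3.
      by apply: zx'; lia.
    rewrite (metric_sym (x' (k + 1))); lra.
  + rewrite (le_trans (x'e k))//.
    have : e k <= eta / 3 by apply: N2P; rewrite /N in kN; lia.
    by lra.
- by move=> k Mk; rewrite ifN//; lia.
- move=> k; case: ifPn => kN; last by rewrite mdistxx addr_ge0// ltW.
  rewrite (le_trans (metric_triangle _ (x k) _))// lerD//.
    by rewrite metric_sym xx'eps//; lia.
  by rewrite metric_sym.
Qed.

(** * Shadowing at a uniform rate *)

(** [T] is chosen before [x]: the surgery windows depend only on the level and on [e], so one rate
    serves all these pseudo-orbits. *)
Lemma uniform_L_shadowing (R : realType) (X : metricType R) (f : homeo X) :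
  compact [set: X] -> L_shadowing f -> forall eps : R, 0 < eps ->
  exists2 delta : R, 0 < delta & forall e : int -> R,
    (forall k, e k <= delta) -> vanishing e ->
    exists2 T : nat -> nat, T 0%N = 0%N &
      forall x, pseudo_orbit f e x -> exists z, forall j k,
        (T j <= `|k|)%N -> mdist (homeo_iter f k z) (x k) <= eps / 2 ^+ j.
Proof.
move=> cX shf eps eps0; pose h n := eps / 2 ^+ n.
have h0 n : 0 < h n by rewrite divr_gt0// exprn_gt0.
have hS n : h n = h n.+1 + h n.+1.
  by rewrite /h exprS; field.
have h_small r : 0 < r -> exists n, h n <= r := @half_powers_small R eps r.
have h_le m n : (m <= n)%N -> h n <= h m.
  elim: n => [|n IH]; first by rewrite leqn0 => /eqP->.
  rewrite leq_eqVlt => /orP[/eqP->//|/IH]; apply: le_trans.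
  by have := hS n; have := h0 n.+1; lra.
pose shadowed n e := forall x, pseudo_orbit f e x -> exists z,
    (forall k, mdist (homeo_iter f k z) (x k) <= h n) /\
    vanishing (fun k => mdist (homeo_iter f k z) (x k)).
(* [D n] allows shadowing within [h n.+2], so a surgery moves points by at most
   [h n.+2 + h n.+2 = h n.+1]. The bound [d <= h n] sends the errors to zero. *)
have [n|D D_spec] := @choice nat R (fun n d => [/\ 0 < d, d <= h n &
    forall e, (forall k, e k <= d) -> vanishing e -> shadowed n.+2 e]).
  have [d d0 dP] := shf _ (h0 n.+2).
  exists (Num.min d (h n)); split; first by rewrite lt_min d0 h0.
    by rewrite ge_min lexx orbT.
  move=> e ed e0 x xe.
  have [k||z [zx zx0]] := dP x.
  - by rewrite (le_trans (xe k))// (le_trans (ed k))// ge_min lexx.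
  - apply/vanishingP => [k|]; first exact: mdist_ge0.
    exact: vanishing_le e0.
  - exists z; split => //; apply/vanishingP => // k; exact: mdist_ge0.
exists (D 0%N) => [|e eD e0]; first by have [] := D_spec 0%N.
pose surgery n e M := forall x, pseudo_orbit f e x -> exists y,
    [/\ pseudo_orbit f (fun=> D n.+1) y,
        forall k, (M <= `|k|)%N -> y k = x k &
        forall k, mdist (x k) (y k) <= h n.+1].
have [[n e'] /=|M MP] := @choice (nat * (int -> R)) nat (fun p M =>
    (forall k, p.2 k <= D p.1) -> vanishing p.2 -> surgery p.1 p.2 M).
  have [[e'D e'0]|nP] := pselect ((forall k, e' k <= D n) /\ vanishing e').
    have [_ _ /(_ _ e'D e'0) sh] := D_spec n.
    have [D0 _ _] := D_spec n.+1.
    have [N NP] := pseudo_orbit_surgery cX (h0 n.+2) D0 e'0 sh.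
    by exists N => _ _; rewrite /surgery hS.
  by exists 0%N => e'D e'0; case: nP.
(* [E n] bounds the errors after [n] surgeries. If [|k|] exceeds the window bound, then [|k + 1|] is
   at least that bound, so [k] and [k + 1] are both untouched and the old error persists. *)
pose E := fix E n := if n is m.+1 then
    (fun k => if (`|k| <= M (m, E m))%N then D n else Num.min (D n) (E m k))
  else e.
have ED n k : E n k <= D n.
  case: n => [|n]; first exact: eD.
  by rewrite /=; case: ifP => // _; rewrite ge_min lexx.
have E0 n : vanishing (E n).
  elim: n => [//|n IH] r /IH[N NP]; exists (maxn N (M (n, E n)).+1) => k Nk /=.
  rewrite ifN; last by lia.
  by rewrite ge_min NP ?orbT//; lia.
have EM n : surgery n (E n) (M (n, E n)) := MP (n, E n) (ED n) (E0 n).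
(* Beyond T j the first j surgeries changed nothing, so only the later ones,
   of total size at most h j, contribute. *)
pose T := fix T n := if n is m.+1 then maxn (T m) (M (m, E m)) else 0%N.
exists T => // x xe.
(* [h j - h n] is the telescoped sum of the displacements [h i.+1] for [j <= i < n], that is, of the
   surgeries after the first [j]. *)
have [n|Y YP] := @choice nat (int -> X) (fun n y => pseudo_orbit f (E n) y /\
    forall j k, (j <= n)%N -> (T j <= `|k|)%N -> mdist (x k) (y k) <= h j - h n).
  elim: n => [|n [y [yE yx]]].
    exists x; split => // j k; rewrite leqn0 => /eqP-> _.
    by rewrite mdistxx subrr.
  have [y' [y'D y'y yy']] := EM n y yE.
  exists y'; split=> [k|j k].
    rewrite /=; case: ifPn => Mk; first exact: y'D.
    by rewrite le_min y'D/= !y'y//; lia.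
  rewrite leq_eqVlt => /orP[/eqP->|].
    rewrite /= geq_max => /andP[Tk Mk]; rewrite y'y// subrr.
    by have := yx n k (leqnn n) Tk; rewrite subrr.
  rewrite ltnS => jn Tk; rewrite (le_trans (metric_triangle _ (y k) _))//.
  by have := yx j k jn Tk; have := yy' k; have := hS n; lra.
have cXZ : compact [set y : {ptws int -> X} | forall k, [set: X] (y k)].
  exact: (@tychonoff int (fun=> X) (fun=> setT) (fun=> cX)).
(* The [Y n] are chosen separately for each [n] and need not converge; a cluster point suffices
   because the conditions passed to it are closed. *)
pose F := (Y : nat -> {ptws int -> X}) @ \oo.
have [|w [_ wY]] := cXZ F (fmap_proper_filter _ eventually_filter).
  by exists 0%N.
have w_closed (A : set {ptws int -> X}) N : closed A ->
    (forall n, (N <= n)%N -> A (Y n)) -> A w.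
  move=> cA AY; apply: cA => B /wY; apply.
  by exists N => // n /AY.
(* The errors of [Y m] are at most [D m <= h m], which tends to zero, so the cluster point is an
   exact orbit. *)
have fw k : f (w k) = w (k + 1).
  apply: mdist_positivity; apply/eqP; rewrite eq_le mdist_ge0 andbT.
  apply/ler_addgt0Pl => r /h_small[n hr]; rewrite addr0 (le_trans _ hr)//.
  apply: (w_closed [set y | mdist (f (y k)) (y (k + 1)) <= h n] n).
    apply: closed_mdist_le.
    - move=> y; apply: (@continuous_comp _ _ _
        (fun y : {ptws int -> X} => y k) f).
        exact: ptws_eval_continuous.
      exact: homeo_fun_continuous.
    - exact: ptws_eval_continuous.
  move=> m nm /=; have [YE _] := YP m; rewrite (le_trans (YE k))//.
  rewrite (le_trans (ED m k))// (le_trans _ (h_le _ _ nm))//.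
  by have [] := D_spec m.
exists (w 0) => j k Tk; rewrite (homeo_iter_orbit fw) metric_sym.
apply: (w_closed [set y | mdist (x k) (y k) <= h j] j).
  apply: closed_mdist_le; last exact: ptws_eval_continuous.
  exact: cst_continuous.
move=> n jn /=; have [_ /(_ j k jn Tk)] := YP n.
by move=> /le_trans; apply; rewrite gerBl ltW.
Qed.

(** * Transfer between points and compact sets *)

Theorem theorem1 (R : realType) (X : metricType R) (f : homeo X)
    (cX : compact [set: X]%classic) :
  L_shadowing f <-> L_shadowing (hyper_homeo f).
Proof.
split=> [shf eps eps0|shF eps /shF[d d0 dP]].
  have [d d0 dP] := uniform_L_shadowing cX shf eps0.
  exists d => // A Ad A0.
  set e := fun k => mdist (hyper_homeo f (A k)) (A (k + 1)) in Ad A0.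
  have e0 : vanishing e by apply/vanishingP => // k; exact: mdist_ge0.
  have [T T0 TP] := dP e Ad e0.
  (* The two halves of the Hausdorff distance between the image of [A k] and [A (k + 1)] give
     successors and predecessors respectively. *)
  have follow m a : hyper_set (A m) a -> exists x,
      [/\ x m = a, forall k, hyper_set (A k) (x k) & pseudo_orbit f e x].
    apply: (@int_chain X (fun k => hyper_set (A k))
      (fun k a b => mdist (f a) b <= e k)) => [k b Ab|k b Ab].
      have [c Ac bc] := point_dist_attained (f b) (A (k + 1)).
      exists c; rewrite // bc.
      by apply: (@point_dist_le_hausdorff _ _ (hyper_homeo f (A k))); exists b.
    have [_ [c Ac <-] bc] := point_dist_attained b (hyper_homeo f (A k)).
    exists c; rewrite // metric_sym bc /e metric_sym.
    exact: point_dist_le_hausdorff.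
  (* Measuring the distance to [A k], rather than to a chosen pseudo-orbit, makes [C] an
     intersection of closed sets. *)
  pose C := [set z | forall j k, (T j <= `|k|)%N ->
    point_dist (homeo_iter f k z) (A k) <= eps / 2 ^+ j].
  have C_near m a : hyper_set (A m) a -> exists2 z, C z &
      forall j, (T j <= `|m|)%N -> mdist (homeo_iter f m z) a <= eps / 2 ^+ j.
    move=> /follow[x [<- xA /TP[z zx]]]; exists z => [j k Tk|j]; last exact: zx.
    by rewrite (le_trans (point_dist_le _ (xA k)))// zx.
  have cC : compact C.
    apply: (subclosed_compact _ cX) => //.
    have -> : C = \bigcap_j \bigcap_(k in [set k | (T j <= `|k|)%N])
        [set z | point_dist (homeo_iter f k z) (A k) <= eps / 2 ^+ j].
      by apply/seteqP; split=> [z Cz j _ k|z Cz j k]; [exact: Cz|exact: Cz].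
    apply: closed_bigI => j _; apply: closed_bigI => k _.
    exact/closed_point_dist_le/homeo_iter_continuous.
  have C0 : C !=set0.
    have [a /C_near[z Cz _]] := hyper_neq0 (A 0).
    by exists z.
  have CA j k : (T j <= `|k|)%N ->
      mdist (homeo_iter (hyper_homeo f) k (Hyperspace cC C0)) (A k)
        <= eps / 2 ^+ j.
    (* One half of the Hausdorff bound is the definition of [C]; the other uses a pseudo-orbit
       through [a] at time [k]. *)
    move=> Tk; apply: hausdorff_dist_le => [b|a /C_near[z Cz za]].
      by rewrite hyper_homeo_iter => -[z Cz <-]; exact: Cz.
    have zC : hyper_set (homeo_iter (hyper_homeo f) k (Hyperspace cC C0))
        (homeo_iter f k z) by rewrite hyper_homeo_iter; exists z.
    by rewrite (le_trans (point_dist_le _ zC))// metric_sym za.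
  exists (Hyperspace cC C0); split=> [k|].
    (* Since [T 0 = 0], level 0 gives the bound [eps] at every time. *)
    by have := CA 0%N k; rewrite T0 expr0 divr1; apply.
  apply/vanishingP => [k|r r0]; first exact: mdist_ge0.
  have [j jr] := half_powers_small eps r0.
  by exists (T j) => k /CA /le_trans; apply.
exists d => // x xd x0.
pose S a : hyperspace X := Hyperspace (@compact_set1 _ a) (ex_intro _ a erefl).
have S_le k : mdist (hyper_homeo f (S (x k))) (S (x (k + 1))) <=
    mdist (f (x k)) (x (k + 1)).
  apply: hausdorff_dist_le => [_ [_ -> <-]|_ ->].
    exact: (@point_dist_le _ _ _ (S _)).
  rewrite metric_sym; apply: point_dist_le; exact: imageP.
have [k||C [Cx C0]] := dP (S \o x).
- exact: le_trans (S_le k) (xd k).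
- apply/vanishingP => [k|]; first exact: mdist_ge0.
  apply: vanishing_le S_le _; apply/vanishingP => // k; exact: mdist_ge0.
have [z Cz] := hyper_neq0 C.
(* The distance from a point to a singleton is the distance to its element, so the Hausdorff
   distance controls every point of [C]. *)
have z_le k : mdist (homeo_iter f k z) (x k) <=
    mdist (homeo_iter (hyper_homeo f) k C) (S (x k)).
  have zC : hyper_set (homeo_iter (hyper_homeo f) k C) (homeo_iter f k z).
    by rewrite hyper_homeo_iter; exists z.
  have := point_dist_le_hausdorff (S (x k)) zC; apply: le_trans.
  by apply: le_point_dist => _ ->.
exists z; split=> [k|]; first exact: le_trans (z_le k) (Cx k).
apply/vanishingP => [k|]; first exact: mdist_ge0.
apply: vanishing_le z_le _; apply/vanishingP => // k; exact: mdist_ge0.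
Qed.
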